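(* Let $X_1,\dots,X_n$ be i.i.d. exponential random variables with mean $1$, let $X_{(1)}=\min_i X_i$, and let $\eta_{(1)}$ be the smallest critical point of $P_n(z)=(z-X_1)\cdots(z-X_n)$. Then $n\log n\,(\eta_{(1)}-X_{(1)})\to1$ in probability as $n\to\infty$.
   Context: Critical points are zeros of $P_n'$; they are all real since $P_n$ has only real zeros. *)

(* Defs.v *)
From HB Require Import structures.
From mathcomp Require Import all_boot all_order all_algebra.
From mathcomp Require Import all_classical all_reals all_analysis.
Set Implicit Arguments. Unset Strict Implicit. Unset Printing Implicit Defensive.
Import Order.TTheory GRing.Theory Num.Theory.
Local Open Scope classical_set_scope.
Local Open Scope ring_scope.

Definition mutually_independent d (T : measurableType d) (R : realType)
  (P : probability T R) (X : nat -> {RV P >-> R}) : Prop :=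
  forall (s : seq nat) (B : nat -> set R),
    uniq s -> (forall i, measurable (B i)) ->
    P (\bigcap_(i in [set` s]) (X i @^-1` B i)) =
    (\prod_(i <- s) P (X i @^-1` B i))%E.

Definition iid_exp1 d (T : measurableType d) (R : realType)
  (P : probability T R) (X : nat -> {RV P >-> R}) : Prop :=
  mutually_independent X /\
  forall i (A : set R), measurable A ->
    distribution P (X i) A = exponential_prob (1 : R) A.

(* P_n(z) = (z - X_1) ... (z - X_n), with X_1..X_n = X 0 .. X (n-1). *)
Definition Pn (T : Type) (R : realType) (X : nat -> T -> R) (n : nat) (w : T)
  : {poly R} := \prod_(i < n) ('X - (X i w)%:P).

Definition eta1 (T : Type) (R : realType) (X : nat -> T -> R) (n : nat) (w : T)
  : R := inf [set z : R | root (Pn X n w)^`() z].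

Definition Xmin1 (T : Type) (R : realType) (X : nat -> T -> R) (n : nat) (w : T)
  : R := inf [set X i w | i in `I_n].

(* Main.v *)
(** Write [x_1, ..., x_n] for the sample and [t] for a point with at most one
    sample point below it, say [x_i].  Then [P_n'/P_n] shows that [t] lies to the
    left of the smallest critical point iff
    [(t - x_i) * sum_(j != i) 1 / (x_j - t) < 1].  With [t = X_(1) + c / (n ln n)]
    the question becomes whether [c * sum_(j != 1) 1 / (X_j - t)] exceeds
    [n ln n], and this sum is asymptotic to [n ln n] in probability: the sample
    points beyond [M / n] contribute [n ln n + O(n)] with variance [O(n^2)] (the
    function [1 / x] is replaced by a step function on cells of width [1 / n], so
    that only indicators of pairwise independent events occur), while the points
    below [M / n] are, with high probability, boundedly many and separated by
    gaps of order [1 / n], hence contribute only [O(n)]. *)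

Require Import Defs.
From HB Require Import structures.
From mathcomp Require Import all_boot all_order all_algebra.
From mathcomp Require Import all_classical all_reals all_analysis.
From mathcomp Require Import measurable_realfun ring lra.
From mathcomp Require polyrcf.
Import Order.TTheory GRing.Theory Num.Theory.
Local Open Scope classical_set_scope.
Local Open Scope ring_scope.

Set Implicit Arguments.
Unset Strict Implicit.

(** * The smallest critical point of a split polynomial *)

Lemma seq_argmin (R : realDomainType) (s : seq R) : s != [::] ->
  exists2 m, m \in s & {in s, forall x, m <= x}.
Proof.
elim: s => // a [_ _|b s IH _].
  by exists a => [|x]; rewrite mem_seq1 // => /eqP->.
have [//|m ms mP] := IH; have [am|/ltW ma] := leP a m.
  exists a; first exact: mem_head.
  by move=> x; rewrite inE => /predU1P[->//|/mP]; exact: le_trans.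
exists m; first by rewrite inE ms orbT.
by move=> x; rewrite inE => /predU1P[->//|/mP].
Qed.

Lemma inf_eq_min (R : realType) (A : set R) (m : R) :
  A m -> lbound A m -> inf A = m.
Proof.
move=> Am mA; apply/eqP; rewrite eq_le ge_inf //=; last by exists m.
by apply: lb_le_inf => //; exists m.
Qed.

(** A nonzero polynomial has finitely many roots, so the infimum is a minimum; [z0] excludes the
    empty set, on which [inf] is only a default value. *)
Lemma inf_root_is_root (R : realType) (p : {poly R}) (z0 : R) :
  p != 0 -> root p z0 ->
  root p (inf [set z | root p z]) /\
  forall z, root p z -> inf [set z | root p z] <= z.
Proof.
move=> p0 pz0; pose s := polyrcf.rootsR p.
have sE x : (x \in s) = root p x.
  have /polyrcf.roots_onP/(_ x) := polyrcf.roots_on_rootsR p0.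
  by rewrite in_itv /= => ->.
have [|m ms mP] := @seq_argmin _ s.
  by apply/eqP => s0; move: pz0; rewrite -sE s0.
have -> : inf [set z | root p z] = m.
  apply: inf_eq_min; first by rewrite /= -sE.
  by move=> x /=; rewrite -sE => /mP.
by split=> [|z]; rewrite -sE // => /mP.
Qed.

(** Logarithmic derivative of a split polynomial, taken away from its roots. *)
Lemma deriv_prod_XsubC_horner (R : fieldType) (I : eqType) (s : seq I)
    (x : I -> R) (z : R) : {in s, forall i, z != x i} ->
  (\prod_(i <- s) ('X - (x i)%:P))^`().[z] =
  (\prod_(i <- s) (z - x i)) * \sum_(i <- s) (z - x i)^-1.
Proof.
elim: s => [_|i s IH zs]; first by rewrite !big_nil derivC horner0 mulr0.
have zi : z - x i != 0 by rewrite subr_eq0 zs ?mem_head.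
rewrite !big_cons derivM derivXsubC mul1r hornerD hornerM IH; last first.
  by move=> j js; rewrite zs // inE js orbT.
rewrite horner_prod hornerXsubC mulrDr mulrAC mulfV // mul1r -mulrA; congr (_ + _).
by apply: eq_bigr => j _; rewrite hornerXsubC.
Qed.

Section smallest_critical_point.
Variables (R : realType) (n : nat) (x : 'I_n -> R).
Let p : {poly R} := \prod_(i < n) ('X - (x i)%:P).
Let q (i : 'I_n) (z : R) := \prod_(j < n | j != i) (z - x j).

(** The factor of index [i] is split off before the logarithmic derivative is taken, so that the
    formula survives at [z = x i]. *)
Let derivp_horner i z : (forall j, j != i -> z != x j) ->
  p^`().[z] = q i z * (1 - (z - x i) * \sum_(j < n | j != i) (x j - z)^-1).
Proof.
move=> zx; rewrite /p (bigD1 i) //= derivM derivXsubC mul1r hornerD hornerM.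
rewrite hornerXsubC -big_filter deriv_prod_XsubC_horner; last first.
  by move=> j; rewrite mem_filter => /andP[/zx].
rewrite horner_prod !big_filter mulrDr mulr1 mulrCA; congr (_ + _).
  by apply: eq_bigr => j _; rewrite hornerXsubC.
rewrite -mulrN; congr (_ * (_ * _)).
by rewrite -sumrN; apply: eq_bigr => j _; rewrite -invrN opprB.
Qed.

(** The product [(z - x i) * sum] is nonpositive for [z <= x i] and increases with [z] on
    [[x i, t]], so its bound at [t] holds at every [z <= t] and the bracket in [derivp_horner] stays
    positive. *)
Let noroot_below i t z : (forall j, j != i -> t < x j) ->
  (t - x i) * \sum_(j < n | j != i) (x j - t)^-1 < 1 -> z <= t ->
  ~~ root p^`() z.
Proof.
move=> tx lt1 zt; have zx j : j != i -> z < x j by move=> /tx; exact: le_lt_trans.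
rewrite rootE (@derivp_horner i); last by move=> j /zx /lt_eqF ->.
rewrite mulf_neq0 //.
  by apply/prodf_neq0 => j /zx zj; rewrite subr_eq0 lt_eqF.
rewrite gt_eqF // subr_gt0; have [zi|iz] := leP z (x i).
  rewrite (le_lt_trans _ ltr01) // mulr_le0_ge0 ?subr_le0 ?sumr_ge0 // => j /zx zj.
  by rewrite invr_ge0 subr_ge0 ltW.
apply: le_lt_trans lt1; rewrite ler_pM ?subr_ge0 ?(ltW iz) ?lerB //.
  by apply: sumr_ge0 => j /zx zj; rewrite invr_ge0 subr_ge0 ltW.
apply: ler_sum => j ji; have := tx j ji; have := zx j ji => zj tj.
by rewrite lef_pV2 ?posrE ?subr_gt0 ?lerB.
Qed.

(** Equal sample points give a double root of [p]; distinct ones give a critical point between them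
    by Rolle. *)
Let two_below_root i j t : i != j -> x i <= t -> x j <= t ->
  exists2 z, root p^`() z & z <= t.
Proof.
move=> ij; wlog xij : i j ij / x i <= x j => [hw xi xj|xi xj].
  by have [|/ltW] := leP (x i) (x j) => xij;
    [apply: (hw i j) | apply: (hw j i) => //; rewrite eq_sym].
have pE : p = ('X - (x i)%:P) * (('X - (x j)%:P) *
    \prod_(k < n | (k != i) && (k != j)) ('X - (x k)%:P)).
  by rewrite /p (bigD1 i) //= (bigD1 j) 1?eq_sym.
move: xij; rewrite le_eqVlt => /predU1P[xij|xij].
  exists (x i) => //; rewrite rootE pE -xij !derivM derivXsubC.
  by rewrite !hornerE subrr !(mul0r, mulr0, addr0).
have [|c] := @polyrcf.poly_rolle _ _ _ p xij.
  by rewrite pE !hornerM !hornerXsubC !subrr !(mul0r, mulr0).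
rewrite in_itv /= => /andP[_ cj] pc; exists c; first by rewrite rootE pc.
exact: le_trans (ltW cj) xj.
Qed.

(** Intermediate values on [[x i, t]]: [q i] has the same sign at both ends, all its factors being
    negative, while the bracket is [1] at [x i] and nonpositive at [t]. *)
Let crossing_root i t : (forall j, j != i -> t < x j) -> 
  1 <= (t - x i) * \sum_(j < n | j != i) (x j - t)^-1 ->
  exists2 z, root p^`() z & z <= t.
Proof.
move=> tx ge1; have xit : x i <= t.
  rewrite leNgt; apply/negP => ti; move: ge1; apply/negP; rewrite -ltNge.
  rewrite (le_lt_trans _ ltr01) // mulr_le0_ge0 ?subr_le0 ?(ltW ti) ?sumr_ge0 // => j /tx tj.
  by rewrite invr_ge0 subr_ge0 ltW.
have [|z] := @polyrcf.poly_ivt _ p^`() (x i) t xit.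
  rewrite !(@derivp_horner i); try by move=> j /tx tj; rewrite lt_eqF // (le_lt_trans xit).
  rewrite subrr mul0r subr0 mulr1 mulrA mulr_ge0_le0 ?subr_le0 //.
  rewrite -big_split /=; apply: prodr_ge0 => j /tx tj.
  by rewrite mulr_le0 ?subr_le0 ?(ltW tj) ?(le_trans xit) ?(ltW tj).
by rewrite in_itv /= => /andP[_ zt] rz; exists z.
Qed.

Lemma lt_inf_root_deriv_prod_XsubC t : (1 < n)%N ->
  t < inf [set z | root p^`() z] <->
  exists i, (forall j, j != i -> t < x j) /\
    (t - x i) * \sum_(j < n | j != i) (x j - t)^-1 < 1.
Proof.
move=> n1; have n0 := ltnW n1.
have [i xi] : exists i, forall j, x i <= x j.
  by case: (@arg_minP _ _ _ (Ordinal n0) xpredT x) => // i _ xi; exists i => j; exact: xi.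
have p'0 : p^`() != 0.
  have lt1 z : z < x i -> (z - x i) * \sum_(j < n | j != i) (x j - z)^-1 < 1.
    move=> zi; rewrite (le_lt_trans _ ltr01) // mulr_le0_ge0 ?subr_le0 ?(ltW zi) //.
    by apply: sumr_ge0 => j _; rewrite invr_ge0 subr_ge0 (le_trans (ltW zi)).
  have zi : x i - 1 < x i by rewrite gtrBl.
  have : ~~ root p^`() (x i - 1).
    by apply: noroot_below (lt1 _ zi) (lexx _) => j _; rewrite (lt_le_trans zi).
  by case: eqP => // ->; rewrite root0.
have [z0 rz0] : exists z, root p^`() z.
  (* This is where two sample points are needed: both lie below their maximum, which forces a
     critical point to exist. *)
  pose m := Num.max (x (Ordinal n0)) (x (Ordinal n1)).
  have [//|||z rz _] := @two_below_root (Ordinal n0) (Ordinal n1) m.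
  - by rewrite le_max lexx.
  - by rewrite le_max lexx orbT.
  by exists z.
have [rinf inf_le] := inf_root_is_root p'0 rz0.
split=> [tinf|[k [tx lt1]]]; last first.
  by rewrite ltNge; apply: contraL rinf; exact: noroot_below tx lt1.
have gt_root z : root p^`() z -> t < z by move=> /inf_le; exact: lt_le_trans.
have tx j : j != i -> t < x j.
  move=> ji; rewrite ltNge; apply/negP => jt.
  have [//|z /gt_root tz zt] := @two_below_root j i t ji jt _.
    exact: le_trans jt.
  by rewrite leNgt tz in zt.
exists i; split=> //; rewrite ltNge; apply/negP => ge1.
by have [z /gt_root tz] := crossing_root tx ge1; rewrite leNgt tz.
Qed.
End smallest_critical_point.

(** * Deterministic bounds on the first gap *)

Lemma exists_grid_cell (R : realFieldType) (h y : R) (N : nat) :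
  0 < h -> 0 < y -> y <= N%:R * h ->
  exists2 a, (a < N)%N & a%:R * h < y <= a.+1%:R * h.
Proof.
move=> h0 y0; elim: N => [|N IH]; first by rewrite mul0r leNgt y0.
move=> yN; have [/IH[a aN aP]|Ny] := leP y (N%:R * h).
  by exists a => //; rewrite (ltn_trans aN).
by exists N => //; rewrite Ny.
Qed.

Lemma grid_cell_inj (R : realFieldType) (h y : R) (k l : nat) : 0 < h ->
  k%:R * h < y <= k.+1%:R * h -> l%:R * h < y <= l.+1%:R * h -> k = l.
Proof.
move=> h0; wlog kl : k l / (k <= l)%N => [hw yk yl|/andP[_ yk] /andP[ly _]].
  by have [kl|/ltnW kl] := leqP k l; [exact: hw|symmetry; exact: hw].
have := lt_le_trans ly yk; rewrite ltr_pM2r // ltr_nat ltnS => lk.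
by apply/eqP; rewrite eqn_leq kl.
Qed.

(* [1 / y] discretised on the cells [(k/n, (k+1)/n]] with [M <= k < n], and [0]
   elsewhere. *)
Definition harm_cell (R : realFieldType) (M n : nat) (y : R) : R :=
  \sum_(k < n | (M <= k)%N)
    n%:R / k%:R * (k%:R / n%:R < y <= k.+1%:R / n%:R)%R%:R.

(** The cells are disjoint, so at most one term of the sum survives. *)
Lemma harm_cellP (R : realFieldType) (M n : nat) (y : R) :
  harm_cell M n y = 0 \/
  exists k : 'I_n, [/\ (M <= k)%N, k%:R / n%:R < y <= k.+1%:R / n%:R
    & harm_cell M n y = n%:R / k%:R].
Proof.
have [/existsP[k /andP[Mk ky]]|none] := boolP [exists k : 'I_n,
    (M <= k)%N && (k%:R / n%:R < y <= k.+1%:R / n%:R)].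
  right; exists k; split=> //; rewrite /harm_cell (bigD1 k) //= ky mulr1.
  rewrite big1 ?addr0 // => l /andP[Ml lk].
  have [ly|_] := boolP (_ < y <= _); last by rewrite mulr0.
  have n0 : 0 < n%:R^-1 :> R by rewrite invr_gt0 ltr0n (leq_ltn_trans _ (ltn_ord k)).
  by case/eqP: lk; apply: val_inj; exact: (grid_cell_inj n0 ly ky).
left; rewrite /harm_cell big1 // => k Mk; case: (boolP (_ < y <= _)) => ky; last by rewrite mulr0.
by case/existsP: none; exists k; rewrite Mk.
Qed.

Lemma harm_cell_ge0 (R : realFieldType) (M n : nat) (y : R) : 0 <= harm_cell M n y.
Proof. by apply: sumr_ge0 => k _; rewrite !mulr_ge0 ?invr_ge0 ?ler0n. Qed.

Lemma harm_cell_eq0 (R : realFieldType) (M n : nat) (y : R) :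
  y <= M%:R / n%:R -> harm_cell M n y = 0.
Proof.
move=> yM; have [//|[k [Mk /andP[ky _] _]]] := harm_cellP M n y.
have := lt_le_trans ky yM; rewrite ltNge ler_wpM2r ?invr_ge0 ?ler0n //.
by rewrite ler_nat.
Qed.

(** On cell [k] the step value is [n / k] and [1 / y >= n / (k + 1)]; their ratio is at worst
    [M / (M + 1)] because [k >= M]. *)
Lemma harm_cell_le (R : realFieldType) (M n : nat) (y : R) : (0 < M)%N -> 0 < y ->
  harm_cell M n y * (M%:R / M.+1%:R) <= y^-1.
Proof.
move=> M0 y0; have [->|[k [Mk /andP[ky yk] ->]]] := harm_cellP M n y.
  by rewrite mul0r invr_ge0 ltW.
have k0 : 0 < k%:R :> R by rewrite ltr0n (leq_trans M0).
have n0 : 0 < n%:R :> R by rewrite ltr0n (leq_ltn_trans _ (ltn_ord k)).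
have M0' : 0 < M%:R :> R by rewrite ltr0n.
have k1 : 0 < k.+1%:R :> R by rewrite ltr0n.
have M1 : 0 < M.+1%:R :> R by rewrite ltr0n.
apply: (@le_trans _ _ (n%:R / k.+1%:R)); last first.
  by rewrite -[n%:R]invrK -invfM lef_pV2 ?posrE // ?mulr_gt0 ?invr_gt0 // mulrC.
have -> : n%:R / k.+1%:R = n%:R / k%:R * (k%:R / k.+1%:R) :> R.
  by rewrite mulrA divfK ?gt_eqF.
rewrite ler_pM2l ?divr_gt0 // ler_pdivrMr // mulrAC ler_pdivlMr // -!natrM ler_nat.
by rewrite !mulnS mulnC leq_add2r.
Qed.

(** The added [1] covers [y > 1], a range that the cells do not reach. *)
Lemma inv_le_harm_cell (R : realFieldType) (M n : nat) (y : R) :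
  (0 < M)%N -> (0 < n)%N -> M%:R / n%:R < y -> y^-1 <= harm_cell M n y + 1.
Proof.
move=> M0 n0 My; have n0' : 0 < n%:R :> R by rewrite ltr0n.
have y0 : 0 < y by apply: le_lt_trans My; rewrite divr_ge0 ?ler0n.
have [y1|y1] := leP y 1; last first.
  apply: (@le_trans _ _ 1); first by rewrite invf_le1 // ltW.
  by rewrite lerDr harm_cell_ge0.
have [|//||k kn ky] := @exists_grid_cell _ n%:R^-1 y n.
- by rewrite invr_gt0.
- by rewrite mulfV ?gt_eqF.
have Mk : (M <= k)%N.
  case/andP: ky => _ /(lt_le_trans My); rewrite ltr_pM2r ?invr_gt0 //.
  by rewrite ltr_nat ltnS.
have k0 : 0 < k%:R :> R by rewrite ltr0n (leq_trans M0).
apply: (@le_trans _ _ (n%:R / k%:R)).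
  rewrite -[n%:R]invrK -invfM lef_pV2 ?posrE // ?mulr_gt0 ?invr_gt0 // mulrC.
  by case/andP: ky => /ltW.
rewrite /harm_cell (bigD1 (Ordinal kn)) //= ky mulr1 -addrA lerDl addr_ge0 //.
by apply: sumr_ge0 => l _; rewrite !mulr_ge0 ?invr_ge0 ?ler0n.
Qed.

(** No cell of width [h] holds two points, since none of the doubled cells does; points are thus
    injected into the first [N] cells. *)
Lemma card_separated_near (R : realFieldType) (n N : nat) (x : 'I_n -> R) (h : R) :
  0 < h -> (forall i, 0 < x i) ->
  (forall (a : nat) i j, (a < N)%N -> i != j ->
     a%:R * h < x i <= a.+2%:R * h -> ~~ (a%:R * h < x j <= a.+2%:R * h)) ->
  (#|[pred j | (x j <= N%:R * h)%R]| <= N)%N.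
Proof.
move=> h0 x0 sep.
(* The extra index keeps the type inhabited when [N = 0]; points within range never map to
   [ord_max], which restores the bound [N]. *)
have cellP j : exists a : 'I_N.+1, x j <= N%:R * h ->
    (a < N)%N /\ a%:R * h < x j <= a.+1%:R * h.
  have [xj|_] := leP (x j) (N%:R * h); last by exists ord0.
  have [a aN ajP] := exists_grid_cell h0 (x0 j) xj.
  by exists (Ordinal (ltnW aN : a < N.+1)%N).
have [f fP] := choice cellP.
have widen a y : a%:R * h < y <= a.+1%:R * h -> a%:R * h < y <= a.+2%:R * h.
  by move=> /andP[-> /le_trans]; apply; rewrite ler_pM2r // ler_nat.
rewrite -(@card_in_image _ _ f); last first.
  move=> i j; rewrite !inE => /fP[fi xi] /fP[fj xj] fij.
  apply/eqP/negPn/negP => ij; have := sep _ i j fi ij (widen _ _ xi).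
  by rewrite fij widen.
apply: (@leq_trans #|predC1 (@ord_max N)|); last by rewrite cardC1 card_ord.
apply: subset_leq_card; apply/fintype.subsetP => a /fintype.imageP[j]; rewrite !inE => /fP[fj _] ->.
by apply/eqP => fN; rewrite fN ltnn in fj.
Qed.

Section deterministic_bounds.
Variables (R : realType) (n M K q : nat) (x : 'I_n -> R) (i0 : 'I_n) (eps L m : R).
(** Scales: the minimum is at most [K / n], points up to [M / n] count as near, and [h] is the
    separation of near points. Later [L] is [ln n] and [n * m] is the mean of [G]. *)
Let h : R := (q * n)%:R^-1.
Let G := \sum_(j < n) harm_cell M n (x j).
Let eta := inf [set z | root (\prod_(i < n) ('X - (x i)%:P))^`() z].

Hypotheses (n1 : (1 < n)%N) (q0 : (0 < q)%N) (eps01 : 0 < eps <= 1).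
Hypotheses (x0 : forall i, 0 < x i) (xi0 : forall j, x i0 <= x j)
  (xK : x i0 <= K%:R / n%:R).
Hypothesis sep : forall (a : nat) i j, (a < M * q)%N -> i != j ->
  a%:R * h < x i <= a.+2%:R * h -> ~~ (a%:R * h < x j <= a.+2%:R * h).
Hypotheses (L1 : 1 <= L) (Leps : 16 <= eps * L) (LM : 16 * (M * q ^ 2)%:R <= eps * L)
  (MK : 16 * K.+1%:R <= eps * M%:R).
Hypotheses (mL : `|m - L| <= eps / 8 * L)
  (GL : `|G - n%:R * m| <= eps / 8 * (n%:R * L)).

Let n0 : 0 < n%:R :> R. Proof. by rewrite ltr0n ltnW. Qed.
Let L0 : 0 < L. Proof. exact: lt_le_trans L1. Qed.
Let nL0 : 0 < n%:R * L. Proof. exact: mulr_gt0. Qed.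
Let h0 : 0 < h. Proof. by rewrite invr_gt0 ltr0n muln_gt0 q0 ltnW. Qed.
Let epsM : eps * M%:R <= M%:R.
Proof. by rewrite ler_piMl ?ler0n //; case/andP: eps01. Qed.
Let M16 : 16 <= M%:R :> R.
Proof. have K1 : 1 <= K.+1%:R :> R by rewrite ler1n. have h1 := MK; have h2 := epsM; lra. Qed.
Let M0 : (0 < M)%N.
Proof. by rewrite -(ltr0n R); apply: lt_le_trans M16; rewrite ltr0n. Qed.
Let KM : K%:R <= M%:R :> R.
Proof.
have h1 := MK; have h2 := epsM; have k0 : 0 <= K%:R :> R by rewrite ler0n.
rewrite -natr1 in h1; lra.
Qed.
Let MqhE : (M * q)%:R * h = M%:R / n%:R.
Proof.
by rewrite /h !natrM invfM mulrA mulfK // pnatr_eq0 -lt0n.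
Qed.

(** The minimum lies below the cut-off [M / n], where the step function is zero. *)
Let GE : G = \sum_(j < n | j != i0) harm_cell M n (x j).
Proof.
rewrite /G (bigD1 i0) //= harm_cell_eq0 ?add0r //.
by rewrite (le_trans xK) // ler_pM2r ?invr_gt0.
Qed.

Let G_bounds : n%:R * L * (1 - eps / 4) <= G <= n%:R * L * (1 + eps / 4).
Proof.
move: GL mL; rewrite !ler_norml; move: G => g /andP[Glo Ghi] /andP[mlo mhi].
have h1 : n%:R * (- (eps / 8 * L)) <= n%:R * (m - L) by rewrite ler_pM2l.
have h2 : n%:R * (m - L) <= n%:R * (eps / 8 * L) by rewrite ler_pM2l.
by apply/andP; split; lra.
Qed.

(** If [t] were left of [eta], only [x i0] could lie below it; but the reciprocal sum is at least
    [G * M / (M + 1)], and [(1 + eps) * (1 - eps / 4) * (1 - eps / 16) >= 1] contradicts the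
    criterion. *)
Lemma inf_root_deriv_le : eta <= x i0 + (1 + eps) / (n%:R * L).
Proof.
set t := x i0 + _; rewrite leNgt.
apply/negP => /(lt_inf_root_deriv_prod_XsubC x t n1)[i [tx]].
have [e0 e1] := andP eps01.
have d0 : 0 < (1 + eps) / (n%:R * L) by rewrite divr_gt0 //; lra.
have ii0 : i = i0.
  apply/eqP/negPn/negP => ii0; have := tx i0; rewrite eq_sym => /(_ ii0).
  by rewrite ltNge /t lerDl ltW.
rewrite {}ii0 in tx *.
rewrite {1}/t addrAC subrr add0r ltNge => /negP; apply.
rewrite mulrAC ler_pdivlMr // mul1r.
have S : G * (M%:R / M.+1%:R) <= \sum_(j < n | j != i0) (x j - t)^-1.
  rewrite GE mulr_suml; apply: ler_sum => j /tx tj.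
  apply: le_trans (harm_cell_le _ _ _) _ => //.
  by rewrite lef_pV2 ?posrE ?subr_gt0 // gerBl ltW // /t addr_gt0.
have [Glo _] := andP G_bounds.
(* This amounts to [16 <= eps * (M + 1)], which [MK] gives. *)
have Mlo : 1 - eps / 16 <= M%:R / M.+1%:R.
  rewrite ler_pdivlMr ?ltr0n // -[M.+1%:R]natr1.
  by have k1 : 1 <= K.+1%:R :> R; [rewrite ler1n | have mk := MK; lra].
set S0 := \sum_(_ < _ | _) _ in S *.
have : n%:R * L * (1 - eps / 4) * (1 - eps / 16) <= S0.
  apply: le_trans S; apply: ler_pM => //; last by lra.
  by apply: mulr_ge0; [exact: ltW nL0 | lra].
move=> S0lo.
apply: (@le_trans _ _ ((1 + eps) * (n%:R * L * (1 - eps / 4) * (1 - eps / 16)))); last first.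
  by rewrite ler_pM2l //; lra.
rewrite -!mulrA mulrCA ler_pM2l // mulrCA -{1}[L]mulr1 ler_pM2l //; nra.
Qed.

(** The reciprocal sum is split at [M / n]: at most [M * q] near points contribute at most [2 / h]
    each, and far points contribute little more than [1 / x j], hence about [G] in total. *)
Lemma inf_root_deriv_gt : x i0 + (1 - eps) / (n%:R * L) < eta.
Proof.
have [e0 e1] := andP eps01.
set t := x i0 + _; apply/(lt_inf_root_deriv_prod_XsubC x t n1); exists i0.
have q0' : 0 < q%:R :> R by rewrite ltr0n.
have d0 : 0 <= (1 - eps) / (n%:R * L) by rewrite divr_ge0 ?(ltW nL0) //; lra.
have dn : (1 - eps) / (n%:R * L) <= n%:R^-1.
  rewrite ler_pdivrMr // mulrA mulVf ?gt_eqF // mul1r; have l1 := L1; lra.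
(* The shift from [x i0] to [t] uses at most half of the gap [h], because [LM] forces
   [2 * q <= L]. *)
have dle : (1 - eps) / (n%:R * L) * 2 <= h.
  suff : 2 * (1 - eps) <= h * (n%:R * L) by rewrite mulrAC ler_pdivrMr // mulrC.
  have Lq : 2 * q%:R <= L.
    have : (1 * q)%:R <= (M * q ^ 2)%:R :> R.
      by rewrite ler_nat -mulnn mulnA leq_mul2r gt_eqF // muln_gt0 M0.
    have : eps * L <= L by rewrite ler_piMl ?(ltW L0).
    by have lm := LM; have l0 := L0; rewrite mul1n => mq el; lra.
  rewrite /h natrM invfM -mulrA mulKf ?gt_eqF // [X in _ <= X]mulrC ler_pdivlMr //.
  by apply: le_trans Lq; rewrite ler_pM2r //; lra.
(* A point within [h] of the minimum would share the doubled cell that starts at the cell of the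
   minimum. *)
have gap j : j != i0 -> x i0 + h < x j.
  move=> ji0; have [//|//||a aMq ai0] := @exists_grid_cell _ h (x i0) (M * q).
  - by rewrite MqhE (le_trans xK) // ler_pM2r ?invr_gt0.
  rewrite ltNge; apply/negP => xj.
  have [a1 a2] := andP ai0.
  have wid : a.+1%:R * h <= a.+2%:R * h by rewrite ler_pM2r // ler_nat.
  have := sep aMq (i := i0) (j := j); rewrite eq_sym => /(_ ji0).
  rewrite a1 (le_trans a2 wid) => /(_ isT) /negP; apply.
  rewrite (lt_le_trans a1 (xi0 j)) (le_trans xj) // -[a.+2%:R]natr1 mulrDl mul1r lerD2r //.
have tx j : j != i0 -> h / 2 <= x j - t.
  by move=> /gap; rewrite /t => xj; lra.
split=> [j /tx tj|]; first by rewrite -subr_gt0 (lt_le_trans _ tj) // divr_gt0.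
rewrite {1}/t addrAC subrr add0r mulrAC ltr_pdivrMr // mul1r.
have term j : j != i0 -> (x j - t)^-1 <=
    (2 / h) * (x j <= (M * q)%:R * h)%R%:R + (1 + eps / 8) * (harm_cell M n (x j) + 1).
  move=> ji0; have c0 := harm_cell_ge0 M n (x j).
  have c1 : 0 <= (1 + eps / 8) * (harm_cell M n (x j) + 1) by rewrite mulr_ge0 //; lra.
  have xt0 : 0 < x j - t by rewrite (lt_le_trans _ (tx j ji0)) // divr_gt0.
  have [xj|xj] := leP (x j) _.
    rewrite mulr1 (@le_trans _ _ (2 / h)) ?lerDl //.
    by rewrite -[2 / h]invrK invf_div lef_pV2 ?posrE ?divr_gt0 // tx.
  rewrite mulr0 add0r; rewrite MqhE in xj.
  apply: (@le_trans _ _ ((1 + eps / 8) * (x j)^-1)); last first.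
    by rewrite ler_pM2l ?inv_le_harm_cell ?(ltnW n1) //; lra.
  rewrite -[X in X <= _]mul1r ler_pdivrMr // mulrAC ler_pdivlMr // mul1r.
  (* For far points [t <= (K + 1) / n <= eps / 16 * x j], and
     [(1 + eps / 8) * (1 - eps / 16) >= 1]. *)
  have tle : t <= K.+1%:R / n%:R by rewrite /t -[K.+1%:R]natr1 [leRHS]mulrDl mul1r lerD.
  have Kle : K.+1%:R / n%:R <= eps / 16 * (M%:R / n%:R).
    rewrite mulrA ler_pM2r ?invr_gt0 //; have mk := MK; lra.
  have Mle : eps / 16 * (M%:R / n%:R) <= eps / 16 * x j.
    by rewrite ler_pM2l ?ltW //; lra.
  have tle' : t <= eps / 16 * x j by rewrite (le_trans tle) // (le_trans Kle).
  have : (1 + eps / 8) * (x j - eps / 16 * x j) <= (1 + eps / 8) * (x j - t).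
    by rewrite ler_pM2l ?lerB //; lra.
  apply: le_trans; have xj0 := x0 j.
  have ex : 0 <= eps * x j by rewrite mulr_ge0 ?ltW.
  have eex : eps * (eps * x j) <= eps * x j by rewrite ler_piMl.
  by lra.
have : \sum_(j < n | j != i0) (x j - t)^-1 <=
    (eps / 8 * L + (1 + eps / 8) * (L * (1 + eps / 4) + eps / 16 * L)) * n%:R.
  apply: le_trans; first exact: ler_sum term.
  apply: (@le_trans _ _ (2 / h * (M * q)%:R + (1 + eps / 8) * (G + n%:R))).
    apply: (@le_trans _ _ (\sum_(j < n) ((2 / h) * (x j <= (M * q)%:R * h)%R%:R +
         (1 + eps / 8) * (harm_cell M n (x j) + 1)))).
      rewrite [leRHS](bigD1 i0) //= lerDr; apply: addr_ge0.
        by rewrite mulr_ge0 ?divr_ge0 ?(ltW h0).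
      by apply: mulr_ge0; [lra | rewrite addr_ge0 ?harm_cell_ge0].
    rewrite big_split /= -!mulr_sumr; apply: lerD.
      rewrite ler_pM2l ?divr_gt0 // -natr_sum ler_nat.
      apply: leq_trans (card_separated_near h0 x0 sep).
      rewrite -sum1_card [leqRHS]big_mkcond /=; apply: leq_sum => j _.
      by rewrite inE; case: ifP.
    by rewrite big_split /= sumr_const card_ord.
  (* The near contribution; [LM] makes it at most [eps / 8 * L * n]. *)
  have -> : 2 / h * (M * q)%:R = 2 * (M * q ^ 2)%:R * n%:R.
    by rewrite /h invrK -mulnn !natrM; ring.
  have [_ Ghi] := andP G_bounds.
  have l0 := L0; have lm := LM; have le := Leps.
  rewrite [leRHS]mulrDl lerD //; first by rewrite ler_pM2r //; lra.
    rewrite -[leRHS]mulrA ler_pM2l; last lra.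
    rewrite mulrDl lerD //; first by rewrite mulrAC [L * _]mulrC.
    by rewrite ler_peMl ?(ltW n0) //; lra.
move=> /(ler_wpM2l (_ : 0 <= 1 - eps)) /le_lt_trans; apply; first lra.
rewrite [n%:R * L]mulrC mulrA ltr_pM2r //.
have l0 := L0.
(* What remains is [(1 - eps) * (eps / 8 + (1 + eps / 8) * (1 + 5 * eps / 16)) < 1] scaled by [L];
   bounds on the monomials [eps ^ k * L] make it linear. *)
have e1' : eps * (eps * L) <= eps * L by rewrite ler_piMl // mulr_ge0 ?ltW.
have e2 : 0 <= eps * (eps * L) by rewrite !mulr_ge0 ?ltW.
have e3 : eps * (eps * (eps * L)) <= eps * (eps * L) by rewrite ler_piMl.
have e4 : 0 <= eps * (eps * (eps * L)) by rewrite !mulr_ge0 ?ltW.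
have e5 : 0 < eps * L by rewrite mulr_gt0.
lra.
Qed.

End deterministic_bounds.

(** * Exponential law and variance estimates *)

Section exponential_law.
Local Open Scope ereal_scope.
Context d (T : measurableType d) (R : realType) (P : probability T R)
  (Y : {RV P >-> R}).
Hypothesis expY : forall A : set R, measurable A ->
  distribution P Y A = exponential_prob (1 : R) A.

Let lawE (A : set R) : measurable A -> P (Y @^-1` A) = exponential_prob (1 : R) A.
Proof. exact: expY. Qed.

Let mY (A : set R) : measurable A -> measurable (Y @^-1` A).
Proof. exact: measurable_funPTI. Qed.

Lemma expRV_lt0 : P (Y @^-1` `]-oo, 0%R[) = 0.
Proof.
rewrite lawE // /exponential_prob integral0_eq // => x /=; rewrite in_itv /= => x0.
by rewrite lt0_exponential_pdf.
Qed.

Let expRV_le_gt0 (x : R) : (0 < x)%R ->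
  P (Y @^-1` `]-oo, x]) = (1 - expR (- x))%:E.
Proof.
move=> x0; rewrite (_ : `]-oo, x] = `]-oo, 0%R[ `|` `[0%R, x])%classic; last first.
  apply/seteqP; split=> y /=; rewrite !in_itv /=.
    by move=> yx; case: (ltP y 0%R) => ?; [left|right; rewrite yx].
  by case=> [/ltW/le_trans|/andP[]//]; apply; exact: ltW.
rewrite preimage_setU measureU.
- rewrite [X in X + _]expRV_lt0 add0e.
  apply: etrans (lawE _) _ => //.
  by rewrite exponential_prob_itv0c // mulN1r EFinB.
- exact: mY.
- exact: mY.
- rewrite -preimage_setI (_ : _ `&` _ = set0) ?preimage_set0 //.
  apply/seteqP; split=> y //=; rewrite !in_itv /= => -[y0 /andP[]].
  by rewrite leNgt y0.
Qed.

Lemma expRV_le (x : R) : (0 <= x)%R ->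
  P (Y @^-1` `]-oo, x]) = (1 - expR (- x))%:E.
Proof.
rewrite le_eqVlt => /predU1P[<-|]; last exact: expRV_le_gt0.
rewrite oppr0 expR0 subrr; apply/eqP; rewrite eq_le measure_ge0 andbT.
(* The atom at zero is excluded by squeezing: [P (Y <= 0) <= P (Y <= e) <= e] for every [e > 0]. *)
apply/lee_addgt0Pr => e e0; rewrite add0e.
apply: (@le_trans _ _ (P (Y @^-1` `]-oo, e]))).
  apply: le_measure; rewrite ?inE.
  - exact: mY.
  - exact: mY.
  - by move=> t /=; rewrite !in_itv /= => /le_trans; apply; exact: ltW.
rewrite expRV_le_gt0 // lee_fin; by have := expR_ge1Dx (- e)%R => h; lra.
Qed.

Lemma expRV_gt (x : R) : (0 <= x)%R ->
  P (Y @^-1` `]x, +oo[) = (expR (- x))%:E.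
Proof.
move=> x0; rewrite -setCitvl preimage_setC probability_setC; last first.
  exact: (mY (measurable_itv `]-oo, x])).
by rewrite expRV_le // -EFinB; congr EFin; lra.
Qed.

Lemma expRV_itvoc (a b : R) : (0 <= a)%R -> (a <= b)%R ->
  P (Y @^-1` `]a, b]) = (expR (- a) - expR (- b))%:E.
Proof.
move=> a0 ab.
rewrite (_ : Y @^-1` `]a, b] = Y @^-1` `]-oo, b] `\` Y @^-1` `]-oo, a]); last first.
  apply/seteqP; split=> t /=; rewrite !in_itv /=.
    by move=> /andP[ta tb]; rewrite tb; split => //; apply/negP; rewrite -ltNge.
  by move=> [-> /negP]; rewrite -ltNge => ->.
have mNy (x : R) : measurable (Y @^-1` `]-oo, x]) := mY (measurable_itv _).
rewrite measureD //; last first.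
  exact: le_lt_trans (probability_le1 P (mY (measurable_itv _))) (ltry _).
rewrite setIidr; last by move=> t /=; rewrite !in_itv /= => /le_trans; apply.
rewrite [X in X - _](expRV_le (le_trans a0 ab)) [X in _ - X](expRV_le a0) -EFinB.
by congr EFin; lra.
Qed.

Lemma expRV_itvoc_le (a b : R) : (0 <= a)%R -> (a <= b)%R ->
  P (Y @^-1` `]a, b]) <= (b - a)%:E.
Proof.
move=> a0 ab; rewrite expRV_itvoc // lee_fin.
have -> : (- b = - a + - (b - a))%R by ring.
rewrite expRD; have h1 := expR_ge1Dx (- (b - a))%R.
have h2 : (expR (- a) <= 1)%R by rewrite expR_le1; lra.
have h3 := expR_ge0 (- a)%R; nra.
Qed.

(** The density on []a, b]] is at least [expR (- b) >= 1 - b]. *)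
Lemma expRV_itvoc_ge (a b : R) : (0 <= a)%R -> (a <= b)%R ->
  ((1 - b) * (b - a))%:E <= P (Y @^-1` `]a, b]).
Proof.
move=> a0 ab; rewrite expRV_itvoc // lee_fin.
have -> : (- a = - b + (b - a))%R by ring.
rewrite expRD; have h1 := expR_ge1Dx (b - a)%R; have h2 := expR_ge1Dx (- b)%R.
have h3 := expR_ge0 (- b)%R; nra.
Qed.

End exponential_law.

(** * Variance of sums of negatively correlated variables *)

Section negatively_correlated_sums.
Local Open Scope ereal_scope.
Context d (T : measurableType d) (R : realType) (P : probability T R).

Lemma covariance_sumr_le0 (I : eqType) (s : seq I) (V : T -> R) (U : I -> T -> R) :
  V \in Lfun P 2%:E -> {in s, forall i, U i \in Lfun P 2%:E} ->
  {in s, forall i, covariance P V (U i) <= 0} ->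
  covariance P V (\sum_(i <- s) U i)%R <= 0.
Proof.
move=> V2; elim: s => [|i s IH] U2 cov0.
  by rewrite big_nil -[0%R : T -> R]/(cst 0%R) covariance_cst_r.
have U2s : {in s, forall i, U i \in Lfun P 2%:E}.
  by move=> j js; rewrite U2 // inE js orbT.
rewrite big_cons -[X in covariance _ _ X]/(U i \+ \sum_(j <- s) U j)%R.
rewrite covarianceDr ?U2 ?mem_head //; last first.
  by rewrite big_seq rpred_sum ?lee1n //= => j; exact: U2s.
rewrite adde_le0 ?cov0 ?mem_head // IH // => j js.
by rewrite cov0 // inE js orbT.
Qed.

(* Nonpositive rather than vanishing covariances: the cells hit by one and the
   same variable are disjoint events, hence negatively correlated. *)
Lemma variance_sum_le (I : eqType) (s : seq I) (U : I -> T -> R) :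
  uniq s -> {in s, forall i, U i \in Lfun P 2%:E} ->
  {in s &, forall i j, i != j -> covariance P (U i) (U j) <= 0} ->
  'V_P[(\sum_(i <- s) U i)%R] <= \sum_(i <- s) 'V_P[U i].
Proof.
elim: s => [|i s IH] /= => [_ _ _|/andP[is_ us] U2 cov0].
  by rewrite !big_nil -[0%R : T -> R]/(cst 0%R) variance_cst.
have ssub j : j \in s -> j \in i :: s by rewrite inE => ->; rewrite orbT.
have S2 : (\sum_(j <- s) U j)%R \in Lfun P 2%:E.
  by rewrite big_seq rpred_sum ?lee1n //= => ? j js; exact: U2 (ssub _ js).
rewrite !big_cons -[X in 'V_P[X]]/(U i \+ \sum_(j <- s) U j)%R.
rewrite varianceD ?U2 ?mem_head // -[leRHS]adde0 leeD //.
  apply: leeD2l; apply: IH => // [j js|j k js ks]; first exact: U2 (ssub _ js).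
  exact: cov0 (ssub _ js) (ssub _ ks).
rewrite mule_ge0_le0 // covariance_sumr_le0 ?U2 ?mem_head // => j js.
  by rewrite U2 ?ssub.
rewrite cov0 ?mem_head ?ssub //; apply/eqP => ij.
by rewrite ij js in is_.
Qed.

Lemma Lfun2_indic (A : set T) : measurable A -> (\1_A : T -> R) \in Lfun P 2%:E.
Proof.
move=> mA; rewrite inE/=; apply/andP; split; rewrite inE//=.
rewrite /finite_norm unlock poweR_lty//.
rewrite (eq_integral (fun x => (\1_A x)%:E)) => [|x _].
  by rewrite integral_indic // setIT (le_lt_trans (probability_le1 P mA)) // ltry.
rewrite /= ger0_norm ?indicE //; case: (x \in A).
  by rewrite powR1.
by rewrite powR0.
Qed.

Lemma covariance_indic (A B : set T) : measurable A -> measurable B ->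
  covariance P (\1_A) (\1_B) = P (A `&` B) - P A * P B.
Proof.
move=> mA mB; have L1 C : measurable C -> (\1_C : T -> R) \in Lfun P 1.
  by move=> /Lfun2_indic; apply: Lfun_subset12; rewrite fin_num_measure.
have AB : (\1_A * \1_B)%R = \1_(A `&` B) :> (T -> R) by rewrite indicI.
rewrite covarianceE ?AB ?L1 //; last exact: measurableI.
by rewrite !expectation_indic //; exact: measurableI.
Qed.

(** An indicator has variance [P A - P A ^ 2]; the square is dropped. *)
Lemma variance_scaled_indic_le (A : set T) (c : R) : measurable A ->
  'V_P[(c \o* \1_A)%R] <= (c ^+ 2)%:E * P A.
Proof.
move=> mA; rewrite varianceZ ?Lfun2_indic // lee_wpmul2l ?lee_fin ?sqr_ge0 //.
rewrite /variance covariance_indic // setIid -[leRHS]sube0 leeB //.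
by rewrite mule_ge0.
Qed.

Lemma covariance_scaled_indic_le0 (A B : set T) (a b : R) :
  measurable A -> measurable B -> (0 <= a)%R -> (0 <= b)%R ->
  P (A `&` B) <= P A * P B ->
  covariance P (a \o* \1_A)%R (b \o* \1_B)%R <= 0.
Proof.
move=> mA mB a0 b0 AB; have L1 C : measurable C -> (\1_C : T -> R) \in Lfun P 1.
  by move=> /Lfun2_indic; apply: Lfun_subset12; rewrite fin_num_measure.
have L11 : ((\1_A : T -> R) * \1_B)%R \in Lfun P 1 by rewrite Lfun2_mul_Lfun1 ?Lfun2_indic.
rewrite covarianceZl ?L1 ?Lfun_scale ?L1 //; last first.
  by rewrite Lfun2_mul_Lfun1 ?Lfun_scale ?Lfun2_indic ?ler1n.
rewrite covarianceZr ?L1 // covariance_indic // muleA mule_ge0_le0 //.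
  by rewrite mule_ge0 ?lee_fin.
by rewrite sube_le0.
Qed.

Lemma chebyshev_fun (f : T -> R) (eps : R) : measurable_fun setT f -> (0 < eps)%R ->
  P [set w | (eps <= `| f w - fine 'E_P[f] |)%R] <= (eps ^- 2)%:E * 'V_P[f].
Proof.
move=> mf; pose F : {RV P >-> R} := HB.pack f (isMeasurableFun.Build _ _ _ _ f mf).
exact: (@chebyshev _ _ _ P F eps).
Qed.

End negatively_correlated_sums.

(** * Elementary bounds on sums of [1 / k] and [1 / k ^ 2] *)

Section harmonic_sums.
Variable R : realType.
Implicit Types M n : nat.

Lemma ln_succ_sub_le n : (0 < n)%N -> ln n.+1%:R - ln n%:R <= n%:R^-1 :> R.
Proof.
move=> n0; have n0' : 0 < n%:R :> R by rewrite ltr0n.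
rewrite -ln_div ?posrE ?ltr0n // -natr1 mulrDl mulfV ?gt_eqF // mul1r.
by apply: le_ln1Dx; rewrite (@lt_trans _ _ 0) ?invr_gt0 // ltrN10.
Qed.

Lemma inv_succ_le_ln_sub n : (0 < n)%N -> n.+1%:R^-1 <= ln n.+1%:R - ln n%:R :> R.
Proof.
move=> n0; have n0' : 0 < n%:R :> R by rewrite ltr0n.
have n1 : 0 < n.+1%:R :> R by rewrite ltr0n.
rewrite -lerN2 opprB -ln_div ?posrE //.
have -> : n%:R / n.+1%:R = 1 + - n.+1%:R^-1 :> R.
  apply: (mulIf (lt0r_neq0 n1)); rewrite divfK ?gt_eqF // mulrDl mulNr.
  by rewrite mulVf ?gt_eqF // -natr1; ring.
by apply: le_ln1Dx; rewrite ltrN2 invf_lt1 // ltr1n ltnS.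
Qed.

Lemma harmonic_sum_le M n : (0 < M)%N -> (0 < n)%N ->
  \sum_(M <= k < n.+1) k%:R^-1 <= 1 + ln n%:R :> R.
Proof.
move=> M0; elim: n => // -[_ _|n IH _].
  rewrite ln1 addr0; have [M1|M1] := ltnP 1 M; first by rewrite big_geq.
  by rewrite (_ : M = 1%N) ?big_nat1 ?invr1 //; apply/eqP; rewrite eqn_leq M1.
have [nM|Mn] := ltnP n.+2 M.
  by rewrite big_geq // addr_ge0 // ln_ge0 // ler1n.
rewrite big_nat_recr //=; have h1 := IH isT; have h2 := @inv_succ_le_ln_sub n.+1 isT.
by rewrite (le_trans (lerD h1 h2)) // -addrA subrKC.
Qed.

Lemma harmonic_sum_ge M n : (0 < M)%N -> (M <= n)%N ->
  ln n%:R - ln M%:R <= \sum_(M <= k < n) k%:R^-1 :> R.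
Proof.
move=> M0; elim: n => [|n IH]; first by rewrite leqn0 => /eqP M0'; rewrite M0' in M0.
rewrite leq_eqVlt => /predU1P[->|]; first by rewrite subrr big_geq.
rewrite ltnS => Mn; rewrite big_nat_recr //=.
have h1 := IH Mn; have h2 := @ln_succ_sub_le n (leq_trans M0 Mn); lra.
Qed.

(** Telescoping with [1 / (k + 1) ^ 2 <= 1 / k - 1 / (k + 1)]; the term [- n%:R^-1] is what makes
    the induction close. *)
Lemma sum_inv_sqr_le M n : (0 < M)%N -> (0 < n)%N ->
  \sum_(M <= k < n.+1) k%:R ^- 2 <= 2 - n%:R^-1 :> R.
Proof.
move=> M0; elim: n => // -[_ _|n IH _].
  rewrite invr1; have [M1|M1] := ltnP 1 M; first by rewrite big_geq //; lra.
  rewrite (_ : M = 1%N) ?big_nat1 ?expr1n ?invr1; first by lra.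
  by apply/eqP; rewrite eqn_leq M1.
have [nM|Mn] := ltnP n.+2 M.
  by rewrite big_geq // subr_ge0 (@le_trans _ _ 1) ?invf_le1 ?ler1n // ler1n.
rewrite big_nat_recr //=; have h1 := IH isT.
have a0 : 0 < n.+1%:R :> R by rewrite ltr0n.
have b0 : 0 < n.+2%:R :> R by rewrite ltr0n.
suff h2 : n.+2%:R ^- 2 <= n.+1%:R^-1 - n.+2%:R^-1 :> R.
  by rewrite (le_trans (lerD h1 h2)) // addrA subrK.
have -> : n.+1%:R^-1 - n.+2%:R^-1 = (n.+1%:R * n.+2%:R)^-1 :> R.
  move: a0 b0; rewrite -[n.+2%:R]natr1; move: n.+1%:R => a a0 b0; field.
  by rewrite !gt_eqF.
rewrite lef_pV2 ?posrE ?mulr_gt0 ?exprn_gt0 // expr2 ler_pM2r // ler_nat.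
by [].
Qed.

End harmonic_sums.

(** * The truncated harmonic sum of an i.i.d. exponential sample *)

Section iid_exponential.
Local Open Scope ereal_scope.
Context d (T : measurableType d) (R : realType) (P : probability T R)
  (X : nat -> {RV P >-> R}).
Hypothesis iidX : iid_exp1 X.

Let expX i : forall A : set R, measurable A ->
  distribution P (X i) A = exponential_prob (1 : R) A := (proj2 iidX) i.

Let mX i (A : set R) : measurable A -> measurable (X i @^-1` A).
Proof. exact: measurable_funPTI. Qed.

Lemma iid_exp1_pair i j (A B : set R) : i != j -> measurable A -> measurable B ->
  P (X i @^-1` A `&` X j @^-1` B) = P (X i @^-1` A) * P (X j @^-1` B).
Proof.
(* Independence is stated for a family of sets indexed by all of [nat]; only the values at [i] and
   [j] matter here. *)
move=> ij mA mB; pose C k := if k == i then A else B.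
have uij : uniq [:: i; j] by rewrite /= inE ij.
have mC k : measurable (C k) by rewrite /C; case: ifP.
have := proj1 iidX _ _ uij mC.
have Ci : C i = A by rewrite /C eqxx.
have Cj : C j = B by rewrite /C eq_sym (negbTE ij).
rewrite !big_cons big_nil mule1 Ci Cj => <-; congr (P _).
apply/seteqP; split=> w /=.
  move=> [wi wj] k /=; rewrite !inE => /orP[] /eqP->; first by rewrite Ci.
  by rewrite Cj.
move=> wC; split.
  by have := wC i; rewrite /= Ci; apply; rewrite inE eqxx.
by have := wC j; rewrite /= Cj; apply; rewrite !inE eqxx orbT.
Qed.

(** The tail of the minimum of the sample, itself exponential with rate [n]. *)
Lemma iid_exp1_all_gt n (a : R) : (0 <= a)%R ->
  P (\bigcap_(i in [set` iota 0 n]) X i @^-1` `]a, +oo[) = (expR (- (n%:R * a)))%:E.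
Proof.
move=> a0; rewrite (proj1 iidX (iota 0 n) (fun=> `]a, +oo[%classic)) ?iota_uniq //.
rewrite (eq_bigr (fun=> (expR (- a))%:E)) => [|i _]; last exact: (expRV_gt (expX i) a0).
rewrite -mulrN expRM_natl big_const_seq count_predT size_iota.
by elim: n => [|n IH] //=; rewrite IH -EFinM -exprS.
Qed.

Lemma iid_exp1_le0 n : P (\big[setU/set0]_(i < n) X i @^-1` `]-oo, 0%R]) = 0.
Proof.
apply/eqP; rewrite eq_le measure_ge0 andbT.
apply: (le_trans (Boole_inequality _ (fun i _ => mX i (measurable_itv _)))).
by rewrite big1 // => i _; apply: etrans (expRV_le (expX i) (lexx _)) _; rewrite oppr0 expR0 subrr.
Qed.

Section harm_cell_sum.
Variables M n : nat.
Hypotheses (M0 : (0 < M)%N) (n0 : (0 < n)%N).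

Let cell (k : nat) : set R := [set` `]k%:R / n%:R, k.+1%:R / n%:R]%R].
Let A (jk : 'I_n * 'I_n) := X jk.1 @^-1` cell jk.2.
Let s := [seq jk : 'I_n * 'I_n <- index_enum ('I_n * 'I_n)%type | (M <= jk.2)%N].
Let U (jk : 'I_n * 'I_n) : T -> R := ((n%:R / jk.2%:R) \o* \1_(A jk))%R.
Let prob (k : nat) : R := (expR (- (k%:R / n%:R)) - expR (- (k.+1%:R / n%:R)))%R.

Definition harm_cell_sum (w : T) : R := (\sum_(j < n) harm_cell M n (X j w))%R.
Definition harm_cell_mean : R := (\sum_(M <= k < n) n%:R / k%:R *
  (expR (- (k%:R / n%:R)) - expR (- (k.+1%:R / n%:R))))%R.

Let mA jk : measurable (A jk). Proof. exact: (mX jk.1 (measurable_itv _)). Qed.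

(** Flattening to pairs (sample point, cell) exhibits a weighted sum of indicators, ready for the
    variance bound. *)
Let harm_cell_sumE : harm_cell_sum = (\sum_(jk <- s) U jk)%R.
Proof.
apply/funext => w; rewrite fct_sumE big_filter /harm_cell_sum /harm_cell.
rewrite (pair_big xpredT (fun k : 'I_n => (M <= k)%N)) /=.
apply: eq_bigr => -[j k] _; rewrite /U /= mulrC indicE; congr ((nat_of_bool _)%:R * _)%R.
by apply/idP/idP; rewrite inE /A /cell /= in_itv.
Qed.

Let cell_le k : (k%:R / n%:R <= k.+1%:R / n%:R :> R)%R.
Proof. by rewrite ler_pM2r ?invr_gt0 ?ltr0n // ler_nat. Qed.

Let PA jk : P (A jk) = (prob jk.2)%:E.
Proof. by rewrite /A /cell (expRV_itvoc (expX _)) // divr_ge0. Qed.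

Let cell_width k : (k.+1%:R / n%:R - k%:R / n%:R = n%:R^-1 :> R)%R.
Proof. by rewrite -mulrBl -[k.+1%:R]natr1 addrAC subrr add0r mul1r. Qed.

Let prob_le k : (prob k <= n%:R^-1)%R.
Proof.
have k0 : (0 <= k%:R / n%:R :> R)%R by rewrite divr_ge0.
have := expRV_itvoc_le (expX 0) k0 (cell_le k).
by rewrite (expRV_itvoc (expX 0)) // lee_fin cell_width.
Qed.

Let prob_ge k : ((1 - k.+1%:R / n%:R) / n%:R <= prob k)%R.
Proof.
have k0 : (0 <= k%:R / n%:R :> R)%R by rewrite divr_ge0.
have := expRV_itvoc_ge (expX 0) k0 (cell_le k).
by rewrite (expRV_itvoc (expX 0)) // lee_fin cell_width.
Qed.

Let U2 jk : U jk \in Lfun P 2%:E.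
Proof. by rewrite Lfun_scale ?Lfun2_indic ?ler1n. Qed.

Let sum_s (f : nat -> R) :
  (\sum_(jk <- s) f jk.2 = n%:R * \sum_(M <= k < n) f k)%R.
Proof.
rewrite big_filter (eq_bigl (fun jk : 'I_n * 'I_n => xpredT jk.1 && (M <= jk.2)%N)) //.
rewrite -(pair_big xpredT (fun k : 'I_n => (M <= k)%N) (fun _ k => f k)) /=.
rewrite sumr_const card_ord -[LHS]mulr_natl; congr (_ * _)%R.
by rewrite big_geq_mkord.
Qed.

Lemma measurable_harm_cell_sum : measurable_fun setT harm_cell_sum.
Proof.
rewrite harm_cell_sumE fct_sumE; apply: measurable_sum => jk.
by apply: measurable_funM => //; exact: measurable_indic.
Qed.

Lemma expectation_harm_cell_sum : 'E_P[harm_cell_sum] = (n%:R * harm_cell_mean)%:E.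
Proof.
have L1 C : measurable C -> (\1_C : T -> R) \in Lfun P 1.
  by move=> /(Lfun2_indic P); apply: Lfun_subset12; rewrite fin_num_measure.
rewrite harm_cell_sumE -(big_map U xpredT id) expectation_sum; last first.
  by move=> _ /mapP[jk _ ->]; rewrite Lfun_scale ?L1.
rewrite big_map -sum_s -sumEFin; apply: eq_bigr => jk _.
by rewrite expectationZl ?L1 // expectation_indic // PA.
Qed.

(** Two pairs with different sample points are independent, and two cells of one point are disjoint,
    so covariances are nonpositive. Each cell has probability at most [1 / n], so the variances add
    up to at most [n ^ 2] times the sum of [1 / k ^ 2]. *)
Lemma variance_harm_cell_sum_le : 'V_P[harm_cell_sum] <= (2 * n%:R ^+ 2)%:E.
Proof.
rewrite harm_cell_sumE; apply: le_trans (variance_sum_le _ _ _) _.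
- by rewrite filter_uniq ?index_enum_uniq.
- by move=> jk _; exact: U2.
- move=> [i k] [j l] _ _ ne.
  apply: covariance_scaled_indic_le0; rewrite ?divr_ge0 //.
  have [/= ij|ij] := eqVneq i j; last by rewrite /A /cell (iid_exp1_pair ij).
  rewrite (_ : _ `&` _ = set0) ?measure0 ?mule_ge0 //.
  rewrite /A /cell /= ij -preimage_setI (_ : _ `&` _ = set0) ?preimage_set0 //.
  apply/seteqP; split=> y //=; rewrite !in_itv /= => -[yk yl].
  have n0' : (0 < n%:R^-1 :> R)%R by rewrite invr_gt0 ltr0n.
  have kl : k = l by apply: val_inj; exact: (grid_cell_inj n0' yk yl).
  by case/eqP: ne; rewrite ij kl.
apply: (@le_trans _ _ (\sum_(jk <- s) (n%:R * jk.2%:R ^- 2)%:E)).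
  apply: lee_sum => jk _; apply: le_trans (variance_scaled_indic_le _ _ (mA jk)) _.
  rewrite PA -EFinM lee_fin exprMn exprVn.
  rewrite mulrAC ler_wpM2r ?invr_ge0 ?exprn_ge0 //.
  apply: (@le_trans _ _ (n%:R ^+ 2 * n%:R^-1)%R).
    by rewrite ler_wpM2l ?exprn_ge0.
  by rewrite expr2 mulfK // pnatr_eq0 -lt0n.
rewrite sumEFin (sum_s (fun k => n%:R * k%:R ^- 2)%R) lee_fin -mulr_sumr mulrA.
rewrite -expr2 mulrC ler_wpM2r ?exprn_ge0 //.
apply: (@le_trans _ _ (\sum_(M <= k < n.+1) k%:R ^- 2)%R).
  have [Mn|nM] := leqP M n; last by rewrite !big_geq // ltnW.
  by rewrite big_nat_recr //= lerDl invr_ge0 exprn_ge0.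
by apply: le_trans (sum_inv_sqr_le R M0 n0) _; rewrite gerBl.
Qed.

Lemma harm_cell_mean_le : (harm_cell_mean <= 1 + ln n%:R)%R.
Proof.
apply: (@le_trans _ _ (\sum_(M <= k < n) k%:R^-1)%R).
  apply: ler_sum => k _.
  apply: (@le_trans _ _ (n%:R / k%:R * n%:R^-1)%R).
    by rewrite ler_wpM2l ?divr_ge0 // prob_le.
  by rewrite mulrAC mulfV ?mul1r // pnatr_eq0 -lt0n.
apply: le_trans (harmonic_sum_le R M0 n0).
have [Mn|nM] := leqP M n; last by rewrite !big_geq // ltnW.
by rewrite big_nat_recr //= lerDl invr_ge0.
Qed.

(** The decay of the density costs each term at most [(k + 1) / (k * n) <= 2 / n], hence at most [2]
    in total. *)
Lemma harm_cell_mean_ge : (M <= n)%N -> (ln n%:R - ln M%:R - 2 <= harm_cell_mean)%R.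
Proof.
move=> Mn; have n0' : (0 < n%:R :> R)%R by rewrite ltr0n.
apply: (@le_trans _ _ (\sum_(M <= k < n) (k%:R^-1 - 2 / n%:R))%R).
  rewrite sumrB lerB ?harmonic_sum_ge // sumr_const_nat -[leLHS]mulr_natl mulrCA -[leRHS]mulr1.
  by rewrite ler_pM2l // ler_pdivrMr // mul1r ler_nat leq_subr.
rewrite /harm_cell_mean !big_nat; apply: ler_sum => k /andP[Mk kn].
have k0 : (0 < k%:R :> R)%R by rewrite ltr0n (leq_trans M0).
apply: (@le_trans _ _ (n%:R / k%:R * ((1 - k.+1%:R / n%:R) / n%:R))%R); last first.
  by rewrite ler_wpM2l ?divr_ge0 // prob_ge.
have k1 : (1 <= k%:R :> R)%R by rewrite ler1n (leq_trans M0).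
have -> : (n%:R / k%:R * ((1 - k.+1%:R / n%:R) / n%:R) =
    k%:R^-1 - k.+1%:R / k%:R / n%:R :> R)%R.
  by field; rewrite !gt_eqF.
rewrite lerB // ler_pM2r ?invr_gt0 // ler_pdivrMr // -[k.+1%:R]natr1; lra.
Qed.

End harm_cell_sum.

End iid_exponential.

(** * Probability of a deviation *)

Lemma measure_bigsetU_le d (T : measurableType d) (R : realType)
    (mu : {measure set T -> \bar R}) (I : Type) (s : seq I) (F : I -> set T) :
  (forall i, measurable (F i)) ->
  (mu (\big[setU/set0]_(i <- s) F i) <= \sum_(i <- s) mu (F i))%E.
Proof.
move=> mF; elim: s => [|i s IH]; first by rewrite !big_nil measure0.
rewrite !big_cons; apply: le_trans (measureU2 _ _ _) _ => //.
  exact: bigsetU_measurable.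
exact: leeD2l.
Qed.

(** * Pairs of nearby sample points *)

Section close_pairs.
Context d (T : measurableType d) (R : realType) (P : probability T R)
  (X : nat -> {RV P >-> R}) (n N : nat) (h : R).

Let D (a : nat) : set R := [set` `]a%:R * h, a.+2%:R * h]].
Let F (aij : 'I_N * ('I_n * 'I_n)) : set T :=
  if aij.2.1 == aij.2.2 then set0
  else X aij.2.1 @^-1` D aij.1 `&` X aij.2.2 @^-1` D aij.1.

(* The cells [(a h, (a + 2) h]] overlap, so two points of [(0, N h]] at distance at
   most [h] always share one of them. *)
Definition close_pair : set T := \big[setU/set0]_(aij : 'I_N * ('I_n * 'I_n)) F aij.

Let mF aij : measurable (F aij).
Proof.
rewrite /F; case: ifP => // _.
by apply: measurableI; exact: (measurable_funPTI _ (measurable_itv _)).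
Qed.

Lemma measurable_close_pair : measurable close_pair.
Proof. exact: bigsetU_measurable. Qed.

Lemma not_close_pairP w : ~ close_pair w -> forall (a : nat) (i j : 'I_n),
  (a < N)%N -> i != j -> a%:R * h < X i w <= a.+2%:R * h ->
  ~~ (a%:R * h < X j w <= a.+2%:R * h).
Proof.
move=> nw a i j aN ij ai; apply/negP => aj; apply: nw; rewrite /close_pair.
rewrite (bigD1 (Ordinal aN, (i, j))) //=; left.
by rewrite /F /= (negbTE ij); split; rewrite /D /= in_itv.
Qed.

(** Union bound over cells and pairs; by independence, two given points share a doubled cell with
    probability at most [(2 * h) ^ 2]. *)
Lemma prob_close_pair_le : iid_exp1 X -> 0 < h ->
  (P close_pair <= ((N * n * n)%:R * (2 * h) ^+ 2)%:E)%E.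
Proof.
move=> iidX h0; apply: le_trans (measure_bigsetU_le _ _ mF) _.
apply: (@le_trans _ _ (\sum_(aij : 'I_N * ('I_n * 'I_n)) ((2 * h) ^+ 2)%:E)%E).
  apply: lee_sum => -[a [i j]] _; rewrite /F /=; case: ifPn => [_|ij].
    by rewrite measure0 lee_fin sqr_ge0.
  have Xle k : (P (X k @^-1` D a) <= (2 * h)%:E)%E.
    have ah : a%:R * h <= a.+2%:R * h by rewrite ler_pM2r // ler_nat (leq_trans (leqnSn _)).
    have ah0 : 0 <= a%:R * h by rewrite mulr_ge0 // ltW.
    apply: le_trans (expRV_itvoc_le (proj2 iidX k) ah0 ah) _.
    by rewrite lee_fin -[a.+2]addn2 natrD mulrDl [leLHS]addrAC subrr add0r.
  rewrite (iid_exp1_pair iidX ij) //; try exact: measurable_itv.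
  by rewrite expr2 EFinM lee_pmul.
rewrite sumEFin lee_fin sumr_const card_prod card_prod !card_ord mulnA.
by rewrite [leRHS]mulr_natl.
Qed.

End close_pairs.

Lemma measurable_fun_superlevel d (T : measurableType d) (R : realType) (f : T -> R) :
  (forall t, measurable [set w | t < f w]) -> measurable_fun setT f.
Proof.
move=> mf; apply: (measurability _ (RGenOInfty.measurableE R)) => _ [_ [t ->] <-].
rewrite setTI (_ : _ @^-1` _ = [set w | t < f w]); first exact: mf.
by apply/seteqP; split=> w /=; rewrite in_itv /= andbT.
Qed.

(** * Measurability of the minimum and of the smallest critical point *)

Section order_statistics.
Context d (T : measurableType d) (R : realType) (P : probability T R)
  (X : nat -> {RV P >-> R}) (n : nat).

Lemma Xmin1P w : (0 < n)%N -> exists i0 : 'I_n,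
  Xmin1 (fun i => X i : T -> R) n w = X i0 w /\ forall j : 'I_n, X i0 w <= X j w.
Proof.
move=> n0; case: (@arg_minP _ _ _ (Ordinal n0) xpredT (fun i : 'I_n => X i w)) => // i _ iP.
exists i; split=> [|j]; last exact: iP.
apply: inf_eq_min; first by exists (nat_of_ord i) => //=; exact: ltn_ord.
by move=> _ [j /= jn <-]; exact: (iP (Ordinal jn)).
Qed.

Lemma measurable_Xmin1 : (0 < n)%N -> measurable_fun setT (Xmin1 (fun i => X i : T -> R) n).
Proof.
move=> n0; apply: measurable_fun_superlevel => t.
rewrite (_ : [set w | _] = \bigcap_(i in `I_n) X i @^-1` `]t, +oo[).
  by apply: fin_bigcap_measurable => // i _; exact: (measurable_funPTI _ (measurable_itv _)).
apply/seteqP; split=> w /=; have [i [-> iP]] := Xmin1P w n0.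
  by move=> ti j /= jn; rewrite in_itv /= andbT (lt_le_trans ti) // (iP (Ordinal jn)).
by move=> /(_ i (ltn_ord i)); rewrite /= in_itv /= andbT.
Qed.

Lemma measurable_eta1 : (1 < n)%N -> measurable_fun setT (eta1 (fun i => X i : T -> R) n).
Proof.
move=> n1; apply: measurable_fun_superlevel => t.
(* The criterion for [t < eta] as a finite union of events. The inverse is written as a power [-1],
   a measurable function that agrees with it on the positive arguments met here. *)
pose B (i : 'I_n) : set T := (\bigcap_(j in [set j : 'I_n | j != i]) X j @^-1` `]t, +oo[) `&`
  (fun w => (t - X i w) * \sum_(j < n | j != i) (X j w - t) `^ (-1)) @^-1` `]-oo, 1[.
rewrite (_ : [set w | _] = \bigcup_(i in [set: 'I_n]) B i).
  apply: fin_bigcup_measurable => // i _; apply: measurableI.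
    apply: fin_bigcap_measurable => // j _.
    exact: (measurable_funPTI (X j) (measurable_itv `]t, +oo[)).
  have mf : measurable_fun setT
      (fun w => (t - X i w) * \sum_(j < n | j != i) (X j w - t) `^ (-1)); last first.
    by rewrite -[X in measurable X]setTI; exact: (mf measurableT _ (measurable_itv `]-oo, 1[)).
  apply: measurable_funM; first exact: measurable_funB.
  under eq_fun => w do rewrite -big_filter.
  apply: measurable_sum => j.
  apply: (measurableT_comp (@measurable_powR R (-1)) (g := fun w => X j w - t)).
  exact: measurable_funB.
have sumE w (i : 'I_n) : (forall j : 'I_n, j != i -> t < X j w) ->
    \sum_(j < n | j != i) (X j w - t) `^ (-1) = \sum_(j < n | j != i) (X j w - t)^-1.
  by move=> tX; apply: eq_bigr => j /tX tj; rewrite powR_inv1 // subr_ge0 ltW.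
apply/seteqP; split=> w /=.
  move=> /(lt_inf_root_deriv_prod_XsubC (fun i : 'I_n => X i w) t n1)[i [tx lt1]].
  exists i => //; split=> [j /= /tx|]; first by rewrite /= in_itv /= andbT.
  by rewrite /= in_itv /= sumE.
move=> [i _ [tx lt1]]; apply/(lt_inf_root_deriv_prod_XsubC (fun i : 'I_n => X i w) t n1).
have tX (j : 'I_n) : j != i -> t < X j w by move=> /tx; rewrite /= in_itv /= andbT.
by exists i; split => //; move: lt1; rewrite /= in_itv /= sumE.
Qed.

End order_statistics.

Section first_gap.
Context d (T : measurableType d) (R : realType) (P : probability T R)
  (X : nat -> {RV P >-> R}).
Hypothesis iidX : iid_exp1 X.

Let scaled_gap n w : R := n%:R * ln (n%:R : R) *
  (eta1 (fun i => X i : T -> R) n w - Xmin1 (fun i => X i : T -> R) n w).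

Let mX i (A : set R) : measurable A -> measurable (X i @^-1` A).
Proof. exact: measurable_funPTI. Qed.

Let measurable_deviation n eps : (1 < n)%N ->
  measurable [set w | eps < `| scaled_gap n w - 1 |].
Proof.
move=> n1; have mf : measurable_fun setT (fun w => `| scaled_gap n w - 1 |).
  apply: measurableT_comp => //; apply: measurable_funB => //.
  apply: measurable_funM => //; apply: measurable_funB; first exact: measurable_eta1.
  by apply: measurable_Xmin1; exact: ltnW.
rewrite (_ : [set w | _] = setT `&` (fun w => `| scaled_gap n w - 1 |) @^-1` `]eps, +oo[).
  exact: (mf measurableT _ (measurable_itv _)).
by rewrite setTI; apply/seteqP; split=> w /=; rewrite in_itv /= andbT.
Qed.

(** Off four bad events the deterministic bounds apply: a nonpositive point (null), a minimum above
    [K / n], a close pair ([4 * M / q]), and a Chebyshev deviation of the truncated sum. Separating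
    [eps] from [eps'] lets the former be capped at [1]. *)
Lemma prob_scaled_gap_deviation_le (n K M q : nat) (eps eps' : R) :
  (1 < n)%N -> (0 < q)%N -> (0 < M <= n)%N -> 0 < eps <= 1 -> eps <= eps' ->
  1 <= ln n%:R :> R -> 16 <= eps * ln n%:R -> 16 * (M * q ^ 2)%:R <= eps * ln n%:R ->
  16 * K.+1%:R <= eps * M%:R -> ln M%:R + 2 <= eps / 8 * ln n%:R ->
  (P [set w | (eps' < `| scaled_gap n w - 1 |)%R] <=
    (expR (- K%:R) + 4 * M%:R / q%:R + 128 / (eps * ln n%:R) ^+ 2)%:E)%E.
Proof.
move=> n1 q0 /andP[M0 Mn] eps01 eps'P L1 Leps LM MK lnM.
set L : R := ln n%:R in L1 Leps LM lnM *; have [e0 e1] := andP eps01.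
have n0 : (0 < n)%N := ltnW n1.
have n0' : 0 < n%:R :> R by rewrite ltr0n.
have L0 : 0 < L by exact: lt_le_trans L1.
have nL0 : 0 < n%:R * L by exact: mulr_gt0.
pose h : R := (q * n)%:R^-1.
have h0 : 0 < h by rewrite invr_gt0 ltr0n muln_gt0 q0.
pose neg : set T := \big[setU/set0]_(i < n) X i @^-1` `]-oo, 0].
pose late : set T := \bigcap_(i in [set` iota 0 n]) X i @^-1` `](K%:R / n%:R : R), +oo[.
pose close := close_pair X n (M * q) h.
pose G := harm_cell_sum X M n; pose m : R := harm_cell_mean R M n.
pose far : set T := [set w | eps / 8 * (n%:R * L) <= `| G w - fine 'E_P[G] |].
have EG : fine 'E_P[G] = n%:R * m by rewrite /G (expectation_harm_cell_sum iidX M n0).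
have m_neg : measurable neg.
  by apply: bigsetU_measurable => i _; exact: (mX i (measurable_itv `]-oo, 0])).
have m_late : measurable late.
  apply: fin_bigcap_measurable => // i _.
  exact: (mX i (measurable_itv `](K%:R / n%:R : R), +oo[)).
have m_close : measurable close by exact: measurable_close_pair.
have m_far : measurable far.
  have mf : measurable_fun setT (fun w => `| G w - fine 'E_P[G] |).
    apply: measurableT_comp => //; apply: measurable_funB => //.
    exact: (measurable_harm_cell_sum X M n).
  rewrite (_ : far = setT `&`
      (fun w => `| G w - fine 'E_P[G] |) @^-1` `[eps / 8 * (n%:R * L), +oo[).
    exact: (mf measurableT _ (measurable_itv _)).
  by rewrite setTI; apply/seteqP; split=> w /=; rewrite in_itv /= andbT.
have sub : [set w | eps' < `| scaled_gap n w - 1 |] `<=`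
    (neg `|` late) `|` (close `|` far).
  move=> w /=; rewrite ltNge => /negP; apply: contra_notP.
  move=> /not_orP[/not_orP[w_neg w_late] /not_orP[w_close w_far]].
  have [i0 [Xi0 i0P]] := Xmin1P X w n0.
  have x0 (i : 'I_n) : 0 < X i w.
    rewrite ltNge; apply/negP => Xi; apply: w_neg; rewrite /neg (bigD1 i) //=; left.
    by rewrite /= in_itv.
  have xK : X i0 w <= K%:R / n%:R.
    rewrite leNgt; apply/negP => KX; apply: w_late => i /=; rewrite mem_iota /= add0n => iin.
    by rewrite in_itv /= andbT (lt_le_trans KX) // (i0P (Ordinal iin)).
  have sep := not_close_pairP w_close.
  (* The mean lies between [L - ln M - 2] and [L + 1]; [lnM] and [Leps] absorb both errors. *)
  have mL : `|m - L| <= eps / 8 * L.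
    have m1 := harm_cell_mean_le iidX M0 n0; have m2 := harm_cell_mean_ge iidX M0 n0 Mn.
    rewrite -/m -/L in m1 m2; rewrite ler_norml; apply/andP; split; lra.
  have GL : `|G w - n%:R * m| <= eps / 8 * (n%:R * L).
    by rewrite leNgt -EG; apply/negP => /ltW.
  have lo := inf_root_deriv_gt n1 q0 eps01 x0 i0P xK sep L1 Leps LM MK mL GL.
  have hi := inf_root_deriv_le n1 eps01 x0 xK L1 MK mL GL.
  rewrite /scaled_gap Xi0 -/L; apply: le_trans eps'P.
  rewrite -[inf _]/(eta1 (fun i => X i : T -> R) n w) in lo hi.
  have lo' : (1 - eps) / (n%:R * L) < eta1 (fun i => X i : T -> R) n w - X i0 w by lra.
  have hi' : eta1 (fun i => X i : T -> R) n w - X i0 w <= (1 + eps) / (n%:R * L) by lra.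
  rewrite ltr_pdivrMr // mulrC in lo'; rewrite ler_pdivlMr // mulrC in hi'.
  rewrite ler_norml; apply/andP; split; lra.
apply: (@le_trans _ _ (P ((neg `|` late) `|` (close `|` far)))).
  apply: le_measure; rewrite ?inE //; first exact: measurable_deviation.
  by do !apply: measurableU.
apply: le_trans (measureU2 _ _ _) _; [exact: measurableU|exact: measurableU|].
apply: (@le_trans _ _ ((0 + (expR (- K%:R))%:E) +
    ((4 * M%:R / q%:R)%:E + (128 / (eps * L) ^+ 2)%:E))%E); last first.
  by rewrite add0e -!EFinD addrA.
apply: leeD.
  apply: le_trans (measureU2 _ _ _) _ => //; apply: leeD.
    by rewrite le_eqVlt; apply/predU1l; exact: iid_exp1_le0.
  rewrite le_eqVlt; apply/predU1l.
  apply: etrans (iid_exp1_all_gt iidX _ _) _; first by rewrite divr_ge0.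
  by rewrite mulrCA mulfV ?mulr1 // gt_eqF.
apply: le_trans (measureU2 _ _ _) _ => //; apply: leeD.
  apply: le_trans (prob_close_pair_le _ _ iidX h0) _.
  rewrite lee_fin /h !natrM le_eqVlt; apply/orP; left; apply/eqP.
  by field; rewrite !pnatr_eq0 -!lt0n n0 q0.
have e8 : 0 < eps / 8 * (n%:R * L) by rewrite mulr_gt0 // divr_gt0.
apply: le_trans (chebyshev_fun P (measurable_harm_cell_sum X M n) e8) _.
apply: le_trans (lee_wpmul2l _ (variance_harm_cell_sum_le iidX M0 n0)) _.
  by rewrite lee_fin invr_ge0 exprn_ge0 // ltW.
rewrite -EFinM lee_fin le_eqVlt; apply/orP; left; apply/eqP.
by field; rewrite !gt_eqF.
Qed.

End first_gap.

(** * Choice of parameters and convergence in probability *)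

Section convergence.
Context d (T : measurableType d) (R : realType) (P : probability T R)
  (X : nat -> {RV P >-> R}).

Lemma near_ge_ln (b : R) : \forall n \near \oo, b <= ln n%:R.
Proof.
near=> n; have bn : expR b <= n%:R by near: n; exact: nbhs_infty_ger.
by rewrite -[b]expRK ler_ln ?posrE ?expR_gt0 // (lt_le_trans _ bn) ?expR_gt0.
Unshelve. all: by end_near. Qed.

Lemma natr_ge_ex (b : R) : exists2 k, (0 < k)%N & b <= k%:R.
Proof.
exists (Num.bound `|b|).+1 => //; apply: (@le_trans _ _ `|b|); first exact: ler_norm.
by rewrite ltW // (lt_le_trans (archi_boundP (normr_ge0 b))) // ler_nat.
Qed.

Lemma near_prob_scaled_gap_deviation_le (eps rho : R) :
  iid_exp1 X -> 0 < eps -> 0 < rho ->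
  \forall n \near \oo,
    (P [set w | (eps < `| n%:R * ln (n%:R : R)
                           * (eta1 (fun i => X i : T -> R) n w
                              - Xmin1 (fun i => X i : T -> R) n w) - 1 |)%R] <= rho%:E)%E.
Proof.
move=> iidX eps0 rho0; pose e := Num.min eps 1.
have e0 : 0 < e by rewrite lt_min eps0 ltr01.
have e1 : e <= 1 by rewrite ge_min lexx orbT.
have eeps : e <= eps by rewrite ge_min lexx.
(* The order of choice is [K], [M], [q], then [n]: [K] makes [expR (- K)] at most [rho / 3], [M]
   dominates [K / e], and [q] makes [4 * M / q] at most [rho / 3]. *)
have [K K0 Kr] := natr_ge_ex (3 / rho).
have [M M0 Me] := natr_ge_ex (16 * K.+1%:R / e).
have [q q0 qM] := natr_ge_ex (12 * M%:R / rho).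
have r3 : 0 < 3 / rho by rewrite divr_gt0.
near=> n.
have n1 : (1 < n)%N by near: n; exact: nbhs_infty_gt.
have Mn : (M <= n)%N by near: n; exact: nbhs_infty_ge.
have L1 : 1 <= ln n%:R :> R by near: n; exact: near_ge_ln.
have L2 : 16 / e <= ln n%:R :> R by near: n; exact: near_ge_ln.
have L3 : 16 * (M * q ^ 2)%:R / e <= ln n%:R :> R by near: n; exact: near_ge_ln.
have L4 : (ln M%:R + 2) * 8 / e <= ln n%:R :> R by near: n; exact: near_ge_ln.
(* The added [1] ensures that squaring [e * ln n] keeps it above [384 / rho], so the Chebyshev term
   is at most [rho / 3]. *)
have L5 : (384 / rho + 1) / e <= ln n%:R :> R by near: n; exact: near_ge_ln.
rewrite !ler_pdivrMr // in L2 L3 L4 L5 qM.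
have Me' : 16 * K.+1%:R <= e * M%:R by rewrite [leRHS]mulrC -ler_pdivrMr.
have M0n : (0 < M <= n)%N by rewrite M0 Mn.
have e01 : 0 < e <= 1 by rewrite e0 e1.
rewrite [leRHS]mulrC in L2; rewrite [leRHS]mulrC in L3.
have L4' : ln M%:R + 2 <= e / 8 * ln n%:R by lra.
apply: le_trans (prob_scaled_gap_deviation_le iidX n1 q0 M0n e01 eeps L1 L2 L3 Me' L4') _.
rewrite lee_fin; have K1 : expR (- K%:R) <= rho / 3.
  rewrite expRN -[rho / 3]invrK invf_div lef_pV2 ?posrE ?expR_gt0 //.
  by rewrite (le_trans Kr) // (le_trans _ (expR_ge1Dx _)) // lerDr.
have q1 : 4 * M%:R / q%:R <= rho / 3 by rewrite ler_pdivrMr ?ltr0n //; lra.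
have L5' : 128 / (e * ln n%:R) ^+ 2 <= rho / 3.
  have t0 : 0 <= 384 / rho by rewrite divr_ge0 // ltW.
  have eL0 : 0 < e * ln n%:R by rewrite mulr_gt0 // (lt_le_trans ltr01).
  rewrite ler_pdivrMr ?exprn_gt0 //.
  apply: (@le_trans _ _ (rho / 3 * (384 / rho))).
    by rewrite le_eqVlt; apply/predU1l; field; rewrite gt_eqF.
  rewrite ler_pM2l ?divr_gt0 // expr2 [e * _]mulrC.
  apply: le_trans (ler_pM _ _ L5 L5); nra.
lra.
Unshelve. all: by end_near. Qed.

End convergence.

Unset Implicit Arguments.
Set Strict Implicit.

Theorem mainTheorem16 (d : measure_display) (T : measurableType d)
  (R : realType) (P : probability T R) (X : nat -> {RV P >-> R}) :
  iid_exp1 X ->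
  forall eps : R, 0 < eps ->
    (fun n : nat =>
       P [set w | eps < `| n%:R * ln (n%:R : R)
                           * (eta1 (fun i => X i : T -> R) n w
                              - Xmin1 (fun i => X i : T -> R) n w) - 1 |])
      @ \oo --> 0%E.
Proof.
move=> iidX eps eps0; apply/fine_cvgP; split.
  (* Finiteness is read off from the eventual bound with [rho = 1]. *)
  near=> n; rewrite ge0_fin_numE //.
  apply: le_lt_trans (ltry (1 : R)).
  by near: n; exact: near_prob_scaled_gap_deviation_le.
apply/cvgrPdist_le => rho rho0; near=> n.
rewrite sub0r normrN ger0_norm ?fine_ge0 // -lee_fin fineK.
  by near: n; exact: near_prob_scaled_gap_deviation_le.
rewrite ge0_fin_numE //; apply: le_lt_trans (ltry (1 : R)).
by near: n; exact: near_prob_scaled_gap_deviation_le.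
Unshelve. all: by end_near. Qed.
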